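(* Let $q$ be a prime power, let $\mathbb{F}_q$ be the finite field with $q$ elements, and let $W$ be an $n$-dimensional vector space over $\mathbb{F}_q$. Let $\mathcal{S}=\{(U_i,V_i):1\le i\le m\}$ be a system of pairs of subspaces of $W$ such that (i) $U_i\cap V_i=\{0\}$ for each $1\le i\le m$; (ii) for all $i\ne j$ ($1\le i,j\le m$), $U_i\cap V_j\ne\{0\}$ or $U_j\cap V_i\ne\{0\}$. Let $u_i:=\dim(U_i)$ and $v_i:=\dim(V_i)$ for each $1\le i\le m$, and let $0\le j\le n$ be an arbitrary fixed integer. Then $$\sum_{i=1}^m \frac{\Big[ { n-v_i-u_i \atop j-u_i} \Big]_q\, q^{(j-u_i)v_i}}{\Big[ { n \atop j} \Big]_q}\le 1.$$
   Context: For integers $N\ge k\ge 0$ the $q$-binomial (Gaussian) coefficient is $\Big[ { N \atop k} \Big]_q=\frac{[N]_q!}{[N-k]_q!\,[k]_q!}$, where $[N]_q!=\prod_{r=1}^{N}(1+q+\dots+q^{r-1})$ (and $[0]_q!=1$); it equals the number of $k$-dimensional subspaces of an $N$-dimensional vector space over $\mathbb{F}_q$. By convention $\Big[ { N \atop k} \Big]_q=0$ if $k<0$ or $k>N$. *)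

(* Defs.v *)
From mathcomp Require Import all_boot all_order all_algebra.

Set Implicit Arguments.
Unset Strict Implicit.
Unset Printing Implicit Defensive.

Import Order.TTheory GRing.Theory Num.Theory.
Local Open Scope ring_scope.

Definition qfact (q N : nat) : nat :=
  (\prod_(1 <= r < N.+1) \sum_(0 <= i < r) q ^ i)%N.

(* The arguments are integers, so that differences such as j - u are genuine
   (not truncated); the value is 0 unless 0 <= k <= N, and in particular
   whenever N < 0.  In the main branch N, k and N - k are nonnegative, so that
   absz is the identity on them. *)
Definition qbinom (q : nat) (N k : int) : rat :=
  if (0 <= k) && (k <= N) then
    (qfact q `|N|%N)%:R / ((qfact q `|N - k|%N)%:R * (qfact q `|k|%N)%:R)
  else 0.

(* Main.v *)
(* The i-th summand is the proportion, among all j-dimensional subspaces of W, of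
   those X with U_i <= X and X :&: V_i = 0.  By (ii) no X has this property for two
   indices, since U_i :&: V_k <= X :&: V_k and U_k :&: V_i <= X :&: V_i; so the
   proportions add up to at most 1.  Subspaces are counted through their ordered
   bases t, by counting in two ways the pairs (t, w) in which w is a tuple of
   length j - u_i, independent modulo U_i + V_i, and <<t>> = U_i + <<w>>. *)
Require Import Defs.
From mathcomp Require Import all_boot all_order all_algebra all_field.
From mathcomp Require Import ring.

Set Implicit Arguments.
Unset Strict Implicit.
Unset Printing Implicit Defensive.

Import Order.TTheory GRing.Theory Num.Theory.
Local Open Scope ring_scope.

(* The number of k-tuples of a b-dimensional space that are independent modulo an
   a-dimensional subspace.  Truncated subtraction gives the right value 0 when
   a <= b < a + k: the factor at i = b - a vanishes. *)
Definition frame_count (q a b k : nat) : nat :=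
  (\prod_(i < k) (q ^ b - q ^ (a + i)))%N.

Lemma frame_count_shift q a b k :
  frame_count q a (a + b) k = (q ^ (a * k) * frame_count q 0 b k)%N.
Proof.
rewrite expnM -[k in (_ ^ k)%N]card_ord -prod_nat_const -big_split /=.
by apply: eq_bigr => i _; rewrite mulnBr add0n -!expnD.
Qed.

Lemma frame_count_gt0 q a b k :
  (1 < q)%N -> (a + k <= b)%N -> (0 < frame_count q a b k)%N.
Proof.
move=> q_gt1 le_ab; apply: prodn_gt0 => i.
by rewrite subn_gt0 ltn_exp2l //; apply: leq_trans le_ab; rewrite ltn_add2l.
Qed.

Lemma frame_count_eq0 q b k : (b < k)%N -> frame_count q 0 b k = 0%N.
Proof.
by move=> lt_bk; rewrite /frame_count (bigD1 (Ordinal lt_bk)) //= subnn mul0n.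
Qed.

Lemma qfact_gt0 q N : (0 < q)%N -> (0 < qfact q N)%N.
Proof.
move=> q_gt0; rewrite /qfact big_add1 big_mkord; apply: prodn_gt0 => i.
by rewrite big_mkord big_ord_recl /= expn0.
Qed.

Lemma qfactS q N : qfact q N.+1 = (qfact q N * \sum_(i < N.+1) q ^ i)%N.
Proof. by rewrite /qfact big_nat_recr //= [in LHS]big_mkord. Qed.

(** Each factor q^N - q^i is q^i (q - 1) times the q-integer of N - i, and these q-integers are the
    factors of [qfact q N] absent from [qfact q (N - k)]. *)
Lemma frame_count_qfact q N k : (k <= N)%N ->
  (frame_count q 0 N k * qfact q (N - k)
     = (\prod_(i < k) (q ^ i * q.-1)) * qfact q N)%N.
Proof.
elim: k => [|k IHk] lt_kN; first by rewrite /frame_count !big_ord0 subn0.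
rewrite /frame_count !big_ord_recr /= -/(frame_count q 0 N k).
move: (IHk (ltnW lt_kN)); rewrite -(subnSK lt_kN) qfactS.
set s := (\sum_(i < _) _)%N => IH.
have ->: (q ^ N - q ^ (0 + k) = q ^ k * (q.-1 * s))%N.
  rewrite -predn_exp -subn1 mulnBr muln1 -expnD subnSK // subnKC //.
  exact: ltnW.
rewrite [RHS]mulnAC -IH; ring.
Qed.

(** The product of the q^i (q - 1) over i < k is common to both frame counts and cancels. For k > N
    both sides are 0. *)
Lemma qbinomE q N k : (1 < q)%N ->
  qbinom q N%:Z k%:Z = (frame_count q 0 N k)%:R / (frame_count q 0 k k)%:R.
Proof.
move=> q_gt1; rewrite /qbinom lez_nat /=.
case: leqP => [le_kN | lt_Nk]; last by rewrite frame_count_eq0 // mul0r.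
rewrite subzn // !absz_nat.
have q_gt0 : (0 < q)%N := ltnW q_gt1.
have nz M : (qfact q M)%:R != 0 :> rat by rewrite pnatr_eq0 -lt0n qfact_gt0.
have nzk : (frame_count q 0 k k)%:R != 0 :> rat.
  by rewrite pnatr_eq0 -lt0n frame_count_gt0.
have := frame_count_qfact q (leqnn k).
rewrite subnn {1}/qfact big_geq // muln1 => Ekk.
apply/eqP; rewrite eqr_div ?mulf_neq0 // -!natrM eqr_nat mulnA.
by rewrite frame_count_qfact // mulnAC -Ekk mulnC.
Qed.

Section Frames.

Variables (F : finFieldType) (W : vectType F).
Local Notation fW := (finvect_type W).
Implicit Types (A X : {vspace fW}).

(** The dimension equation expresses independence of [w] modulo [A] without a quotient space; for
    [A] = 0 it says that [w] is free. *)
Definition is_frame A X k (w : k.-tuple fW) :=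
  (<<w>> <= X)%VS && (\dim (A + <<w>>) == \dim A + k)%N.

Lemma dim_add_line A (x : fW) :
  \dim (A + <[x]>) = (\dim A + (x \notin A))%N.
Proof.
case: (boolP (x \in A)) => [Ax | nAx] /=.
  by rewrite addn0; congr (\dim _); apply/addv_idPl.
rewrite dimv_disjoint_sum ?dim_vline; last first.
  apply/eqP; rewrite -subv0; apply/subvP => y /memv_capP[Ay /vlineP[c Dy]].
  move: Ay; rewrite Dy rpredZeq (negbTE nAx) orbF => /eqP->.
  by rewrite scale0r mem0v.
by rewrite (_ : x != 0) //; apply: contraNneq nAx => ->; rewrite mem0v.
Qed.

Lemma dim_add_span A k (w : k.-tuple fW) :
  (\dim (A + <<w>>) <= \dim A + k)%N.
Proof.
apply: leq_trans (leq_of_leqif (dimv_add_leqif _ _)) _.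
by rewrite leq_add2l (leq_trans (dim_span _)) ?size_tuple.
Qed.

Lemma is_frame_cons A X k (x : fW) (w : k.-tuple fW) :
  is_frame A X [tuple of x :: w] =
  [&& x \in X, x \notin A & is_frame (A + <[x]>) X w].
Proof.
rewrite /is_frame /= span_cons addvA subv_add -memvE -andbA dim_add_line.
case: (x \in X) => //=; case: (boolP (x \in A)) => [Ax | nAx] /=; last first.
  by rewrite -addnA add1n.
(* If [x] lies in [A], only the [k] vectors of [w] can enlarge [A], so dimension [\dim A + k.+1] is
   out of reach. *)
rewrite ltn_eqF ?andbF // addnS ltnS (addv_idPl (_ : (<[x]> <= A)%VS)) -?memvE //.
exact: dim_add_span.
Qed.

(** Choose the vectors one at a time: the first is any [x] in [X] outside [A], and the rest form a
    frame modulo [A + <[x]>], whose dimension does not depend on [x]. *)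
Lemma card_frames A X k : (A <= X)%VS ->
  #|[set w : k.-tuple fW | is_frame A X w]|
    = frame_count #|F| (\dim A) (\dim X) k.
Proof.
elim: k A => [|k IHk] A sAX.
  rewrite /frame_count big_ord0 (_ : [set _ | _] = setT).
    by rewrite cardsT card_tuple expn0.
  by apply/setP=> w; rewrite !inE /is_frame tuple0 span_nil sub0v addv0 addn0 eqxx.
rewrite -sum1dep_card.
rewrite (reindex (fun p : fW * k.-tuple fW => [tuple of p.1 :: p.2])) /=;
  last first.
  exists (fun w : k.+1.-tuple fW => (thead w, [tuple of behead w])).
    by case=> x w _ /=; congr pair; apply: val_inj.
  by move=> w _; rewrite [RHS]tuple_eta; apply: val_inj.
under eq_bigl => p do rewrite is_frame_cons andbA.
rewrite -(pair_big_dep (fun x => (x \in X) && (x \notin A))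
  (fun x w => is_frame (A + <[x]>) X w) (fun _ _ => 1%N)) /=.
rewrite (eq_bigr (fun=> frame_count #|F| (\dim A).+1 (\dim X) k)); last first.
  move=> x /andP[Xx nAx]; rewrite sum1dep_card IHk; last by rewrite subv_add sAX.
  by rewrite dim_add_line nAx addn1.
rewrite sum_nat_const /frame_count big_ord_recl addn0; congr muln.
  rewrite -!(@card_vspace F fW).
  rewrite -(cardsE (mem X)) -(cardsE (mem A)) -cardsDS.
    by rewrite -cardsE; apply: eq_card => x; rewrite !inE andbC.
  by apply/subsetP=> x; rewrite !inE; apply: (subvP sAX).
by apply: eq_bigr => i _; rewrite /= /bump addSnnS.
Qed.

Definition separating_frames (U V : {vspace fW}) j : {set j.-tuple fW} :=
  [set t : j.-tuple fW | [&& \dim <<t>> == j, (U <= <<t>>)%VS & (<<t>> :&: V == 0)%VS]].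

Lemma separating_frames_disjoint (U V U' V' : {vspace fW}) j :
  (U :&: V' <> 0)%VS \/ (U' :&: V <> 0)%VS ->
  [disjoint separating_frames U V j & separating_frames U' V' j].
Proof.
move=> meetUV; rewrite -setI_eq0; apply/eqP/setP=> t; rewrite !inE.
apply/negP=> /andP[/and3P[_ sUt tV0] /and3P[_ sU't tV'0]].
by case: meetUV; apply; apply/eqP; rewrite -subv0;
  [rewrite -(eqP tV'0) | rewrite -(eqP tV0)]; apply: capvS.
Qed.

(** For fixed [t], the [w] are the frames of [<<t>>] modulo [U]; for fixed [w], the [t] are the
    ordered bases of [U + <<w>>]. Either number is constant, which gives the two products. *)
Lemma card_separating_frames (U V : {vspace fW}) j d :
    (U :&: V = 0)%VS -> (j = \dim U + d)%N ->
  (#|separating_frames U V j| * frame_count #|F| (\dim U) j d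
     = frame_count #|F| (\dim U + \dim V) (\dim {:fW}) d
         * frame_count #|F| 0 j j)%N.
Proof.
move=> dxUV Dj.
(* Both sides force <<t>> = U + <<w>>, of dimension j and disjoint from V. *)
have pairE (t : j.-tuple fW) (w : d.-tuple fW) :
  (t \in separating_frames U V j) && is_frame U <<t>> w
    = is_frame (U + V) fullv w && is_frame 0 (U + <<w>>) t.
  rewrite inE /is_frame subvf add0v dimv0 add0n (dimv_disjoint_sum dxUV) /=.
  have -> : (U + V + <<w>> = U + <<w>> + V)%VS by rewrite -addvA (addvC V) addvA.
  have -> : (\dim U + \dim V + d = j + \dim V)%N by rewrite Dj addnAC.
  rewrite -Dj.
  apply/idP/idP.
    case/andP=> /and3P[/eqP dt sUt /eqP tV0] /andP[swt /eqP dUw].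
    have -> : (U + <<w>> = <<t>>)%VS.
      by apply/eqP; rewrite eqEdim subv_add sUt swt dt dUw leqnn.
    by rewrite (dimv_disjoint_sum tV0) dt subvv !eqxx.
  case/andP=> /eqP dUwV /andP[stUw /eqP dt].
  have dUw : \dim (U + <<w>>)%VS = j.
    apply/eqP; rewrite eqn_leq -{2}dt dimvS // andbT Dj.
    exact: dim_add_span.
  have Dt : (<<t>> = U + <<w>>)%VS.
    by apply/eqP; rewrite eqEdim stUw dt dUw leqnn.
  rewrite dt Dt addvSl addvSr dUw !eqxx !andbT /= -dimv_eq0.
  by have := dimv_sum_cap (U + <<w>>) V; rewrite dUwV dUw => /eqP;
    rewrite -[X in _ == X]addn0 eqn_add2l.
rewrite -sum_nat_const.
transitivity (\sum_(t in separating_frames U V j)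
                \sum_(w : d.-tuple fW | is_frame U <<t>> w) 1)%N.
  apply: eq_bigr => t; rewrite inE => /and3P[/eqP dt sUt _].
  by rewrite sum1dep_card card_frames // dt.
rewrite pair_big_dep /= (eq_bigl _ _ (fun p => pairE p.1 p.2)).
rewrite (reindex (fun p : d.-tuple fW * j.-tuple fW => (p.2, p.1))) /=;
  last first.
  by exists (fun p => (p.2, p.1)) => -[].
rewrite -(pair_big_dep (fun w => is_frame (U + V) fullv w)
  (fun w t => is_frame 0 (U + <<w>>) t) (fun _ _ => 1%N)) /=.
rewrite -(dimv_disjoint_sum dxUV) -(@card_frames (U + V)%VS {:fW}%VS) ?subvf //.
rewrite -sum1dep_card big_distrl /=; apply: eq_bigr => w.
case/andP=> _ /eqP dUVw.
rewrite sum1dep_card card_frames ?sub0v // dimv0 mul1n; congr frame_count.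
apply/eqP; rewrite eqn_leq; apply/andP; split.
  by rewrite Dj dim_add_span.
(* Lower bound: adding [V] raises the dimension by at most [\dim V], yet reaches [j + \dim V]. *)
have := leq_of_leqif (dimv_add_leqif (U + <<w>>)%VS V).
rewrite -addvA (addvC _ V) addvA dUVw (dimv_disjoint_sum dxUV) addnAC -Dj.
by rewrite leq_add2r.
Qed.

End Frames.

(** The two sides are in fact equal; the inequality suffices for the sum and reduces the case
    [j < \dim U], where the q-binomial is 0 by convention, to nonnegativity. *)
Lemma qbinom_separating_frames (F : finFieldType) (W : vectType F)
    (U V : {vspace finvect_type W}) (j : nat) :
    (U :&: V = 0)%VS -> (j <= \dim {:finvect_type W})%N ->
  qbinom #|F| ((\dim {:finvect_type W})%:Z - (\dim V)%:Z - (\dim U)%:Z)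
      (j%:Z - (\dim U)%:Z)
    * #|F|%:R ^ ((j%:Z - (\dim U)%:Z) * (\dim V)%:Z)
    / qbinom #|F| (\dim {:finvect_type W})%:Z j%:Z
  <= #|separating_frames U V j|%:R / (frame_count #|F| 0 (\dim {:finvect_type W}) j)%:R.
Proof.
move=> dxUV le_jn; have q_gt1 : (1 < #|F|)%N := finNzRing_gt1 F.
have [lt_jU | le_Uj] := ltnP j (\dim U).
  by rewrite {1}/qbinom subr_ge0 lez_nat leqNgt lt_jU /= !mul0r divr_ge0 ?ler0n.
have le_UVn : (\dim V + \dim U <= \dim {:finvect_type W})%N.
  by rewrite addnC -(dimv_disjoint_sum dxUV) dimvS ?subvf.
have := card_separating_frames dxUV (esym (subnKC le_Uj)).
set d := (j - \dim U)%N; set r := (\dim {:finvect_type W} - (\dim V + \dim U))%N.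
have -> : (\dim {:finvect_type W})%:Z - (\dim V)%:Z - (\dim U)%:Z = r%:Z.
  by rewrite -addrA -opprD -PoszD subzn.
rewrite subzn // -/d -PoszM -exprnP !qbinomE //.
have -> : frame_count #|F| (\dim U) j d
    = (#|F| ^ (\dim U * d) * frame_count #|F| 0 d d)%N.
  by rewrite -frame_count_shift subnKC.
have -> : frame_count #|F| (\dim U + \dim V) (\dim {:finvect_type W}) d
    = (#|F| ^ ((\dim U + \dim V) * d) * frame_count #|F| 0 r d)%N.
  by rewrite -frame_count_shift (addnC (\dim U)) subnKC.
(* The power [#|F| ^ (\dim U * d)] occurs on both sides; cancelling it leaves the exponent
   [\dim V * d] of the summand. *)
rewrite mulnDl expnD mulnCA -!mulnA => /eqP.
rewrite eqn_pmul2l ?expn_gt0 ?(ltnW q_gt1) // => /eqP.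
move/(congr1 (GRing.natmul (1 : rat))).
rewrite !natrM natrX (mulnC d) => card_eq.
have nz k b : (k <= b)%N -> (frame_count #|F| 0 b k)%:R != 0 :> rat.
  by move=> le_kb; rewrite pnatr_eq0 -lt0n frame_count_gt0.
rewrite le_eqVlt; apply/orP; left; apply/eqP.
move: (nz d d (leqnn d)) (nz j j (leqnn j)) (nz j _ le_jn) card_eq.
set fd := (frame_count _ _ d d)%:R; set fj := (frame_count _ _ j j)%:R.
move=> nz_d nz_j nz_n card_eq.
rewrite invf_div mulrA; congr (_ / _).
by apply: (mulIf nz_d); rewrite card_eq; field.
Qed.

Theorem theorem1p9 (q : nat) (F : finFieldType) (hq : #|F| = q)
    (n : nat) (W : vectType F) (hW : \dim {:W} = n)
    (m : nat) (U V : 'I_m -> {vspace W})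
    (hi : forall i : 'I_m, (U i :&: V i)%VS = 0%VS)
    (hii : forall i j : 'I_m, i != j ->
       (U i :&: V j)%VS <> 0%VS \/ (U j :&: V i)%VS <> 0%VS)
    (u v : 'I_m -> nat)
    (hu : forall i : 'I_m, u i = \dim (U i))
    (hv : forall i : 'I_m, v i = \dim (V i))
    (j : nat) (hj : (j <= n)%N) :
  \sum_(i < m)
     (qbinom q (n%:Z - (v i)%:Z - (u i)%:Z) (j%:Z - (u i)%:Z)
        * q%:R ^ ((j%:Z - (u i)%:Z) * (v i)%:Z)
      / qbinom q n%:Z j%:Z) <= 1 :> rat.
Proof.
subst q n.
(* [W] and its finite copy [finvect_type W] become convertible as vector spaces
   once [W] is exposed as a record constructor. *)
destruct W as [T c]; set W := Vector.Pack c in U V hi hii hu hv hj *.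
pose B i := @separating_frames F W (U i) (V i) j.
pose f := frame_count #|F| 0 (\dim {:finvect_type W}) j.
have f_gt0 : (0 < f)%N by apply: frame_count_gt0; rewrite ?finNzRing_gt1.
apply: (@le_trans _ _ (\sum_(i < m) #|B i|%:R / f%:R)).
  apply: ler_sum => i _; rewrite hu hv.
  exact: (@qbinom_separating_frames F W (U i) (V i) j (hi i) hj).
rewrite -mulr_suml -natr_sum ler_pdivrMr ?ltr0n // mul1r ler_nat.
have -> : (\sum_(i < m) #|B i| = #|\bigcup_(i < m) B i|)%N.
  rewrite -sum1_card partition_disjoint_bigcup => [|i k ne_ik].
    by apply: eq_bigr => i _; rewrite sum1_card.
  by apply: separating_frames_disjoint; apply: hii.
(* Read as frames of the whole space modulo 0, [f] counts all free [j]-tuples, and these include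
   every [B i]. *)
rewrite /f -[X in frame_count _ X](dimv0 (finvect_type W)).
rewrite -card_frames ?sub0v //; apply/subset_leq_card/bigcupsP => i _.
apply/subsetP=> t; rewrite !inE => /and3P[dt _ _].
by rewrite /is_frame subvf add0v dimv0.
Qed.
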